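(* Let $(E,\lambda)$ be a connectivity system and $k\in\mathbb{N}$. Let $P$ be a $k$-profile and let $(Q_\alpha)_{\alpha<\kappa}$ be a (non-empty) increasing chain, indexed by the ordinals less than an ordinal $\kappa$, of elements of $P$ such that its supremum $Q=\bigcup_{\alpha<\kappa}Q_\alpha$ is not contained in $P$. Then the set $$\{S\subseteq E : \lambda(S)\in\mathbb{N}\text{ and there is }\alpha<\kappa\text{ with }(S\cap Q)\cup Q_\alpha\in P\}$$ is a profile of the sets of finite order, and it induces every $l$-profile which induces $P$.
   Context: $\mathbb{N}$ contains $0$. A connectivity system is a (possibly infinite) set $E$ with a map $\lambda:2^E\to\mathbb{N}\cup\{\infty\}$ such that for all $A,B\subseteq E$: $\lambda(A)=\lambda(E\setminus A)$, $\lambda(A)+\lambda(B)\geq\lambda(A\cup B)+\lambda(A\cap B)$, and $\lambda$ is limit-closed: if $n\in\mathbb{N}$ and $(A_i)_{i\in I}$ is a (non-empty) chain with respect to inclusion of subsets of $E$ with $\lambda(A_i)\le n$ for all $i$, then $\lambda(\bigcup_{i}A_i)\leq n$. The value $\lambda(A)$ is the order of $A$. Let $\mathcal{S}$ be a set of subsets of $E$ closed under complements. A profile of $\mathcal{S}$ is a subset $P\subseteq\mathcal{S}$ such that: (i) for every $S\in\mathcal{S}$, $P$ contains exactly one of $S$ and $E\setminus S$; (ii) (consistency) if $R,S\in\mathcal{S}$ with $R\subsetneq S\in P$, then $R\in P$; (iii) (profile property) if $R,S\in P$ then $E\setminus(R\cup S)\notin P$. For $l\in\mathbb{N}$, an $l$-profile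 is a profile of $S_l=\{S\subseteq E:\lambda(S)<l\}$. A profile of the sets of finite order is a profile of $\{S\subseteq E:\lambda(S)\in\mathbb{N}\}$. An $l$-profile $P'$ with $l\geq k$ induces the $k$-profile $P$ if $P'\cap S_k=P$; likewise a profile $\mathcal{Q}$ of the sets of finite order induces an $l$-profile $P'$ if $\mathcal{Q}\cap S_l=P'$. *)

(* Defs.v *)
From mathcomp Require Import all_boot.
From mathcomp Require Import classical_sets wochoice.

Set Implicit Arguments.
Unset Strict Implicit.
Unset Printing Implicit Defensive.

Local Open Scope classical_set_scope.

(* [None] is infinity. *)
Definition enat := option nat.

Definition eadd (x y : enat) : enat :=
  if x is Some m then (if y is Some n then Some (m + n) else None) else None.

Definition ele (x y : enat) : bool :=
  if y is Some n then (if x is Some m then m <= n else false) else true.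

Definition elt (x y : enat) : bool := ~~ ele y x.

(* The ground set is the whole type [E].  Chains are given as non-empty sets of
   subsets of [E] rather than as families; only their members matter. *)
Record connectivity_system (E : Type) := ConnectivitySystem {
  conn_order :> set E -> enat;
  conn_setC : forall A : set E, conn_order A = conn_order (~` A);
  conn_submod : forall A B : set E,
    ele (eadd (conn_order (A `|` B)) (conn_order (A `&` B)))
        (eadd (conn_order A) (conn_order B));
  conn_limit_closed : forall (n : nat) (C : set (set E)),
    C !=set0 -> total_on C subset ->
    (forall A, C A -> ele (conn_order A) (Some n)) ->
    ele (conn_order (\bigcup_(A in C) A)) (Some n)
}.

Section Profiles.
Variable E : Type.
Implicit Types (lambda : connectivity_system E) (P Q : set (set E)).

Definition low_order lambda (l : nat) : set (set E) :=
  [set S | elt (lambda S) (Some l)].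

Definition finite_order lambda : set (set E) :=
  [set S | exists n : nat, lambda S = Some n].

(* Meant for [SS] closed under complements, which holds in the two cases used:
   see [low_order_setC] and [finite_order_setC]. *)
Record is_profile (SS P : set (set E)) : Prop := IsProfile {
  profile_sub : P `<=` SS;
  profile_exactly_one : forall S, SS S ->
    (P S \/ P (~` S)) /\ ~ (P S /\ P (~` S));
  profile_consistent : forall R S, SS R -> SS S -> R `<` S -> P S -> P R;
  profile_property : forall R S, P R -> P S -> ~ P (~` (R `|` S))
}.

Definition is_lprofile lambda (l : nat) P := is_profile (low_order lambda l) P.

Definition induces lambda (l : nat) Q P := Q `&` low_order lambda l = P.

Lemma low_order_setC lambda l S :
  low_order lambda l S -> low_order lambda l (~` S).
Proof. by rewrite /low_order /= -conn_setC. Qed.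

Lemma finite_order_setC lambda S :
  finite_order lambda S -> finite_order lambda (~` S).
Proof. by rewrite /finite_order /= -conn_setC. Qed.

End Profiles.

(* Main.v *)
Require Import Defs.
From mathcomp Require Import all_boot.
From mathcomp Require Import boolp classical_sets wochoice.

(** Write [absorb A S] for [(S `&` Q) `|` A], where [A] runs over the chain [C]
    of the sets [Q_ a]; let [QQ] consist of the finite-order [S] such that
    [absorb A S] is in [P] for some [A].

    The point is that [absorb A S] has order below [k] for all large [A] in
    the chain, however large the finite order of [S] is
    ([eventually_low_absorb]).  Submodularity applied to [S `&` Q] and [A]
    bounds the order of [absorb A S] by the order of [A] plus the order of
    [S `&` Q] minus the order of [S `&` A].  The sets [S `&` A] form a
    chain with union [S `&` Q], so limit-closedness keeps their orders from
    staying cofinally below that of [S `&` Q]: eventually this difference is at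
    most zero.

    Hence [P] eventually decides [absorb A S].  The profile property makes
    membership of [absorb A S] in [P] persist as [A] grows, so [S] is in [QQ]
    exactly if [absorb A S] is in [P] eventually, and the profile axioms for
    [QQ] become the axioms for [P] at one large [A].  For exactly one of [S]
    and its complement, the two absorbed sets have union [Q] and intersection
    [A]; both in [P] would contradict [~` Q] being in [P], and neither would
    contradict [A] being in [P].

    For an [l]-profile [P'] inducing [P] and [S] in [P'], let [S] fail to be in
    [QQ]; then for large [A] the set [absorb A (~` S)] is in [P'], and its union
    with [S] is [S `|` Q].  By submodularity either [S `|` Q] has order
    at most that of [S], and then its complement is in [P'] as a
    subset of [~` Q], against the profile property; or [S `&` Q] has order
    less than that of [Q], so it is in [P] as a subset of [S],
    and absorbing a large [A] puts [S] into [QQ] after all. *)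

Set Implicit Arguments.
Unset Strict Implicit.

Local Open Scope classical_set_scope.

(** * Arithmetic of the order function *)

Section Order.
Variables (E : Type) (lambda : connectivity_system E).
Implicit Types (S A B : set E).

Lemma low_orderP l S :
  low_order lambda l S <-> exists2 n, lambda S = Some n & n < l.
Proof.
rewrite /low_order /= /elt; case: (lambda S) => [m|] /=; last by split=> // -[].
by rewrite -ltnNge; split=> [ml|[n [->]]] //; exists m.
Qed.

Lemma low_order_finite l S : low_order lambda l S -> finite_order lambda S.
Proof. by move=> /low_orderP[n Sn _]; exists n. Qed.

Lemma order_submod {A B a b} :
    lambda A = Some a -> lambda B = Some b ->
  exists u i, [/\ lambda (A `|` B) = Some u, lambda (A `&` B) = Some i
                & u + i <= a + b].
Proof.
move=> Aa Bb; have := conn_submod lambda A B; rewrite Aa Bb /=.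
case: (lambda (A `|` B)) => [u|] //; case: (lambda (A `&` B)) => [i|] // uiab.
by exists u, i.
Qed.

Lemma finite_orderU A B :
  finite_order lambda A -> finite_order lambda B -> finite_order lambda (A `|` B).
Proof. by move=> [a Aa] [b Bb]; have [u [_ [? _ _]]] := order_submod Aa Bb; exists u. Qed.

Lemma finite_orderI A B :
  finite_order lambda A -> finite_order lambda B -> finite_order lambda (A `&` B).
Proof. by move=> [a Aa] [b Bb]; have [_ [i [_ ? _]]] := order_submod Aa Bb; exists i. Qed.

Lemma low_order_bigcup l (C : set (set E)) :
    C !=set0 -> total_on C subset -> C `<=` low_order lambda l ->
  low_order lambda l (\bigcup_(A in C) A).
Proof.
case: l => [|n] C0 Ctot Clow.
  by have [A /Clow/low_orderP[]] := C0.
have : ele (lambda (\bigcup_(A in C) A)) (Some n).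
  apply: conn_limit_closed => // A /Clow/low_orderP[m Am mn].
  by rewrite Am.
case e: (lambda _) => [m|] //= mn.
by apply/low_orderP; exists m.
Qed.

End Order.

(** * Consequences of the profile axioms *)

Section ProfileFacts.
Variables (E : Type) (SS P : set (set E)).
Hypothesis profP : is_profile SS P.
Implicit Types (R S T : set E).

Lemma profile_setC S : SS S -> ~ P S -> P (~` S).
Proof. by move=> /(profile_exactly_one profP)[[]]. Qed.

Lemma profile_subset R S : SS R -> P S -> R `<=` S -> P R.
Proof.
move=> SR PS RS; have [SR'|nSR] := pselect (S `<=` R).
  by rewrite (_ : R = S) //; apply/seteqP.
exact: (profile_consistent profP SR (profile_sub profP PS)).
Qed.

Lemma profile_setU R S : SS (R `|` S) -> P R -> P S -> P (R `|` S).
Proof.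
move=> SRS PR PS; have [//|/(profile_setC SRS)] := pselect (P (R `|` S)).
by move/(profile_property profP PR PS).
Qed.

End ProfileFacts.

(** * The profile of finite-order sets determined by a chain *)

Section Chain.
Variables (E : Type) (lambda : connectivity_system E) (k : nat).
Variables (P C : set (set E)).
Hypotheses (profP : is_lprofile lambda k P) (C0 : C !=set0).
Hypotheses (Ctot : total_on C subset) (CP : C `<=` P).
Local Notation Q := (\bigcup_(A in C) A).
Hypothesis nPQ : ~ P Q.
Implicit Types (R S A B : set E) (p q : set E -> Prop).

Definition absorb A S := (S `&` Q) `|` A.

Definition chain_profile : set (set E) :=
  [set S | finite_order lambda S /\ exists2 A, C A & P (absorb A S)].

Definition eventually_in_chain p :=
  exists2 A, C A & forall B, C B -> A `<=` B -> p B.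

Lemma eventually_and p q :
  eventually_in_chain p -> eventually_in_chain q ->
  eventually_in_chain (fun A => p A /\ q A).
Proof.
move=> [A CA pA] [B CB qB]; have [AB|BA] := Ctot CA CB.
  by exists B => // D CD BD; split; [apply: pA => // x /AB/BD|apply: qB].
by exists A => // D CD AD; split; [apply: pA|apply: qB => // x /BA/AD].
Qed.

Lemma eventually_ex p : eventually_in_chain p -> exists2 A, C A & p A.
Proof. by move=> [A CA pA]; exists A => //; apply: pA. Qed.

Lemma chain_sub_sup A : C A -> A `<=` Q.
Proof. by move=> CA x Ax; exists A. Qed.

Lemma low_order_sup : low_order lambda k Q.
Proof. by apply: low_order_bigcup => // A /CP/(profile_sub profP). Qed.

Lemma setC_sup_in : P (~` Q).
Proof. exact: (profile_setC profP low_order_sup nPQ). Qed.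

Lemma finite_order_capQ S : finite_order lambda S -> finite_order lambda (S `&` Q).
Proof. by move=> fS; apply/(finite_orderI fS)/(low_order_finite low_order_sup). Qed.

(** The traces [S `&` A] of order below [n], if cofinal, would be a chain with
    union [S `&` Q], contradicting limit-closedness. *)
Lemma eventually_order_cap S n : lambda (S `&` Q) = Some n ->
  eventually_in_chain (fun A => ~ low_order lambda n (S `&` A)).
Proof.
move=> Sn; apply: contrapT => nev.
have cof A : C A -> exists B, [/\ C B, A `<=` B & low_order lambda n (S `&` B)].
  move=> CA; apply: contrapT => nB; apply: nev; exists A => // B CB AB lowB.
  by apply: nB; exists B.
pose D := [set T | exists B, [/\ C B, low_order lambda n (S `&` B) & T = S `&` B]].
have unionD : \bigcup_(T in D) T = S `&` Q.
  apply/seteqP; split=> [x [_ [B [CB _ ->]] [Sx Bx]]|x [Sx [A CA Ax]]].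
    by split=> //; exists B.
  have [B [CB AB lowB]] := cof _ CA.
  by exists (S `&` B); [exists B|split=> //; apply: AB].
suff /low_orderP[m] : low_order lambda n (S `&` Q).
  by rewrite Sn => -[->]; rewrite ltnn.
rewrite -unionD; apply: low_order_bigcup => [||T [B [_ lowB ->]] //].
  by have [A /cof[B [CB _ lowB]]] := C0; exists (S `&` B), B.
move=> _ _ [A [CA _ ->]] [B [CB _ ->]].
by have [AB|BA] := Ctot CA CB; [left|right]; apply: setIS.
Qed.

(** Once the order of [S `&` A] is at least that of [S `&` Q], submodularity of
    [S `&` Q] and [A] makes the order of [absorb A S] at most that of [A], which
    is below [k] because [A] is in [P]. *)
Lemma eventually_low_absorb S : finite_order lambda S ->
  eventually_in_chain (fun A => low_order lambda k (absorb A S)).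
Proof.
move=> /finite_order_capQ[n Sn]; have [A0 CA0 ev] := eventually_order_cap Sn.
exists A0 => // A CA /(ev _ CA) nlow.
have /low_orderP[a Aa ak] := profile_sub profP (CP CA).
have [u [i [Uu]]] := order_submod Sn Aa.
rewrite -setIA (setIidr (chain_sub_sup CA)) => Ii ui.
apply/low_orderP; exists u => //; apply: leq_ltn_trans ak.
have ni : n <= i.
  by rewrite leqNgt; apply/negP => il; apply: nlow; apply/low_orderP; exists i.
by rewrite -(leq_add2r n) (addnC a) (leq_trans _ ui) // leq_add2l.
Qed.

(** This turns the existential quantifier in [chain_profile] into an eventual
    one, so that several sets can be tested at a common member of the chain. *)
Lemma chain_profile_eventually S : chain_profile S ->
  eventually_in_chain (fun A => P (absorb A S)).
Proof.
move=> [/eventually_low_absorb[A0 CA0 low] [A CA PA]].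
have step B : C B -> A0 `<=` B -> A `<=` B -> P (absorb B S).
  move=> CB A0B AB.
  (* Enlarging [A] to [B] amounts to taking the union with [B], also in [P]. *)
  have -> : absorb B S = absorb A S `|` B.
    by rewrite /absorb -setUA (setUidr AB).
  apply: (profile_setU profP) => //; last exact: CP.
  by rewrite /absorb -setUA (setUidr AB); apply: low.
have [AA0|A0A] := Ctot CA CA0.
  by exists A0 => // B CB A0B; apply: step => // x /AA0/A0B.
by exists A => // B CB AB; apply: step => // x /A0A/AB.
Qed.

(** The two absorbed sets cover [Q], and [~` Q] is in [P]. *)
Lemma chain_profile_notC S : chain_profile S -> ~ chain_profile (~` S).
Proof.
move=> /chain_profile_eventually evS /chain_profile_eventually evC.
have [A CA [PS PC]] := eventually_ex (eventually_and evS evC).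
apply: (profile_property profP PS PC).
rewrite (_ : _ `|` _ = Q); first exact: setC_sup_in.
apply/seteqP; split=> x.
  by move=> [[[]|]|[[]|]] //; apply: chain_sub_sup.
by have [Sx|nSx] := pselect (S x) => Qx; [left|right]; left.
Qed.

(** The two absorbed sets meet in [A], so if both complements were in [P], the
    complement of their union, [A], could not be. *)
Lemma chain_profile_or S : finite_order lambda S ->
  chain_profile S \/ chain_profile (~` S).
Proof.
move=> fS; have fC := finite_order_setC fS.
have [//|/not_orP[nS nC]] := pselect (chain_profile S \/ chain_profile (~` S)).
have [A CA [lowS lowC]] :=
  eventually_ex (eventually_and (eventually_low_absorb fS) (eventually_low_absorb fC)).
have PS : P (~` absorb A S).
  by apply: (profile_setC profP lowS) => PA; apply: nS; split=> //; exists A.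
have PC : P (~` absorb A (~` S)).
  by apply: (profile_setC profP lowC) => PA; apply: nC; split=> //; exists A.
case: (profile_property profP PS PC).
rewrite (_ : ~` _ = A); first exact: CP.
rewrite setCU !setCK /absorb -setUIl.
by rewrite setIACA setICr set0I set0U.
Qed.

Lemma chain_profile_is_profile : is_profile (finite_order lambda) chain_profile.
Proof.
split=> [S []//|S fS|R S fR fS [RS _] QS|R S QR QS].
- split; first exact: chain_profile_or.
  by move=> [] /chain_profile_notC.
- have [A CA [low PS]] := eventually_ex
    (eventually_and (eventually_low_absorb fR) (chain_profile_eventually QS)).
  split=> //; exists A => //; apply: (profile_subset profP low PS).
  by apply: setSU; apply: setSI.
- apply: chain_profile_notC.
  have fU : finite_order lambda (R `|` S).
    by apply: finite_orderU; [case: QR|case: QS].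
  have [A CA [low [PR PS]]] := eventually_ex
    (eventually_and (eventually_low_absorb fU)
      (eventually_and (chain_profile_eventually QR) (chain_profile_eventually QS))).
  split=> //; exists A => //.
  have e : absorb A (R `|` S) = absorb A R `|` absorb A S.
    by rewrite /absorb setIUl setUACA setUid.
  by rewrite e; apply: (profile_setU profP) => //; rewrite -e.
Qed.

Section Inducing.
Variables (l : nat) (P' : set (set E)).
Hypotheses (kl : k <= l) (profP' : is_lprofile lambda l P').
Hypothesis indP : induces lambda k P' P.

Lemma inducing_sub S : P S -> P' S.
Proof. by rewrite -indP => -[]. Qed.

(** Submodularity of [S] and [Q] leaves two cases: either [S `|` Q] has order at
    most that of [S], or [S `&` Q] has order less than that of [Q]. *)
Lemma inducing_sub_chain_profile : P' `<=` chain_profile.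
Proof.
move=> S P'S; have lowS := profile_sub profP' P'S.
have fS := low_order_finite lowS.
have [//|QC] := chain_profile_or fS.
have /low_orderP[s Ss sl] := lowS; have /low_orderP[q Qq qk] := low_order_sup.
have [u [i [Uu Ii ui]]] := order_submod Ss Qq.
have [us|su] := leqP u s.
  (* Here [S] and [absorb A (~` S)] have union [S `|` Q], whose complement is a
     subset of [~` Q] of order below [l]. *)
  have [_ [A CA /inducing_sub PC]] := QC.
  case: (profile_property profP' P'S PC).
  have e : S `|` absorb A (~` S) = S `|` Q.
    apply/seteqP; split=> x.
      by move=> [|[[]|/(chain_sub_sup CA)]]; [left|right|right].
    by have [Sx|nSx] := pselect (S x) => -[//|Qx]; [left|left|right; left].
  rewrite e; apply: (profile_subset profP' (S := ~` Q)).
  - by apply/low_order_setC/low_orderP; exists u => //; apply: leq_ltn_trans sl.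
  - exact/inducing_sub/setC_sup_in.
  - by apply/subsetC; right.
(* Here [S `&` Q] is in [P], hence so is its union with a large [A]. *)
have iq : i < q.
  by rewrite -(ltn_add2l s) (leq_trans _ ui) // ltn_add2r.
have lowI : low_order lambda k (S `&` Q).
  by apply/low_orderP; exists i => //; apply: ltn_trans qk.
have PI : P (S `&` Q).
  rewrite -indP; split=> //; apply: (profile_subset profP' _ P'S) => //.
  by apply/low_orderP; exists i => //; apply: leq_trans (ltn_trans iq qk) kl.
have [A CA low] := eventually_ex (eventually_low_absorb fS).
split=> //; exists A => //; apply: (profile_setU profP) => //; exact: CP.
Qed.

Lemma chain_profile_induces : induces lambda l chain_profile P'.
Proof.
apply/seteqP; split=> [S [QS lowS]|S P'S]; last first.
  by split; [apply: inducing_sub_chain_profile|apply: (profile_sub profP')].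
apply: contrapT => /(profile_setC profP' lowS)/inducing_sub_chain_profile.
exact: chain_profile_notC.
Qed.

End Inducing.

End Chain.

(** * Well-ordered families *)

Lemma well_order_total (I : Type) (leI : rel I) : well_order leI -> total leI.
Proof.
move=> wo x y; pose pxy := [pred z | `[< z = x \/ z = y >]].
have [|z [[/asboolP zxy lez] _]] := wo pxy; first by exists x; apply/asboolP; left.
have lx : leI z x by apply: lez; apply/asboolP; left.
have ly : leI z y by apply: lez; apply/asboolP; right.
by case: zxy lx ly => -> ? ?; apply/orP; [left|right].
Qed.

(* The ordinals below kappa are rendered as a type I well-ordered by leI. *)
Theorem lemma7p5 (E : Type) (lambda : connectivity_system E) (k : nat)
    (P : set (set E)) (I : Type) (leI : rel I) (Q_ : I -> set E) :
  is_lprofile lambda k P ->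
  well_order leI ->
  inhabited I ->
  (forall a b : I, leI a b -> Q_ a `<=` Q_ b) ->
  (forall a : I, P (Q_ a)) ->
  let Q := \bigcup_(a in [set: I]) Q_ a in
  ~ P Q ->
  let QQ := [set S : set E | finite_order lambda S /\
                             exists a : I, P ((S `&` Q) `|` Q_ a)] in
  is_profile (finite_order lambda) QQ /\
  (forall (l : nat) (P' : set (set E)),
     k <= l -> is_lprofile lambda l P' -> induces lambda k P' P ->
     induces lambda l QQ P').
Proof.
move=> profP wo [a0] mono PQ_ Q nPQ QQ.
pose C := range Q_.
have eQ : \bigcup_(A in C) A = Q by rewrite /C bigcup_image.
have C0 : C !=set0 by exists (Q_ a0), a0.
have CP : C `<=` P by move=> _ [a _ <-].
have Ctot : total_on C subset.
  move=> _ _ [a _ <-] [b _ <-].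
  by have /orP[/mono|/mono] := well_order_total wo a b; [left|right].
have -> : QQ = chain_profile lambda P C.
  rewrite /chain_profile /absorb eQ; apply/seteqP; split=> S [fS].
    by move=> [a Pa]; split=> //; exists (Q_ a); first exists a.
  by move=> [_ [a _ <-] Pa]; split=> //; exists a.
rewrite -eQ in nPQ; split; first exact: (chain_profile_is_profile (k := k)).
by move=> l P' kl profP' indP; apply: (chain_profile_induces (k := k) (P := P)).
Qed.
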